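(* Let $R$ be an integral domain and $M$ a nonzero, non-simple unital $R$-module. If the divisor topology $D(M)$ is a compact space, then $\operatorname{Soc}(M)$ is finitely generated and essential in $M$. In this case, $M$ is a finitely cogenerated module.
   Context: For $m,n\in M$ write $m\mid n$ if $n=rm$ for some $r\in R$ (equivalently $Rn\subseteq Rm$). Put $M^{\#}=\{0\neq m\in M: Rm\neq M\}$ and define an equivalence relation on $M^{\#}$ by $m\sim n$ iff $Rm=Rn$; let $[m]$ be the class of $m$ and $\operatorname{EC}(M^{\#})=\{[m]:m\in M^{\#}\}$. For $m\in M^{\#}$ let $U_m=\{[n]\in \operatorname{EC}(M^{\#}): n\mid m\}$. The family $\{U_m\}_{m\in M^{\#}}$ is a basis of a topology on $\operatorname{EC}(M^{\#})$, called the divisor topology of $M$ and denoted $D(M)$ (also denoting the resulting space). A space is compact if every open covering has a finite subcover. A submodule $N$ of $M$ is essential if, for every submodule $L$ of $M$, $N\cap L=0$ implies $L=0$. The socle $\operatorname{Soc}(M)$ is the sum of all simple submodules of $M$ (and is $0$ if there are none). $M$ is finitely cogenerated if for every family $\{N_i\}_{i\in\Delta}$ of submodules of $M$ with $\bigcap_{i\in\Delta}N_i=0$ there is a finite subset $\Delta'\subseteq\Delta$ with $\bigcap_{i\in\Delta'}N_i=0$. *)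

(* Defs.v *)
From HB Require Import structures.
From mathcomp Require Import all_boot all_order all_algebra generic_quotient.
From mathcomp Require Import boolp classical_sets cardinality topology.

Set Implicit Arguments.
Unset Strict Implicit.
Unset Printing Implicit Defensive.

Import GRing.Theory.
Local Open Scope classical_set_scope.
Local Open Scope ring_scope.
Local Open Scope quotient_scope.

Section Modules.
Variables (R : nzRingType) (M : lmodType R).
Implicit Types (m n : M) (N L : set M).

Definition submodule N : Prop := submod_closed (mem N).

Definition cyclic_submodule m : set M := range (fun r : R => r *: m).

Definition mdivides m n : Prop := exists r : R, n = r *: m.

Definition simple_submodule N : Prop :=
  [/\ submodule N, N <> [set 0]
    & forall L, submodule L -> L `<=` N -> L = [set 0] \/ L = N].

Definition nonzero_module : Prop := [set: M] <> [set 0].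

Definition simple_module : Prop := simple_submodule [set: M].

(* Finite sums of elements, each taken from some simple submodule; the empty
   sum makes the socle zero when there are no simple submodules. *)
Definition socle : set M :=
  [set x | exists s : seq M,
     (forall y, y \in s -> exists2 N, simple_submodule N & N y)
     /\ x = \sum_(y <- s) y].

Definition finitely_generated N : Prop :=
  exists (k : nat) (g : 'I_k -> M),
    N = [set x | exists c : 'I_k -> R, x = \sum_(i < k) c i *: g i].

Definition essential N : Prop :=
  submodule N
  /\ forall L, submodule L -> N `&` L = [set 0] -> L = [set 0].

Definition finitely_cogenerated : Prop :=
  forall (I : Type) (N : I -> set M),
    (forall i, submodule (N i)) -> \bigcap_i N i = [set 0] ->
    exists2 D : set I, finite_set D & \bigcap_(i in D) N i = [set 0].

Definition sharp : set M := [set m | m != 0 /\ cyclic_submodule m <> setT].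

Definition sharp_type : choiceType := {m : M | `[< sharp m >]}.

Definition associates (m n : sharp_type) : bool :=
  `[< cyclic_submodule (val m) = cyclic_submodule (val n) >].

Lemma associates_refl : reflexive associates.
Proof. by move=> m; apply/asboolP. Qed.

Lemma associates_sym : symmetric associates.
Proof. by move=> m n; apply/asboolP/asboolP. Qed.

Lemma associates_trans : transitive associates.
Proof. by move=> n m p /asboolP mn /asboolP np; apply/asboolP; rewrite mn. Qed.

Canonical associates_equiv : equiv_rel sharp_type :=
  EquivRel associates associates_refl associates_sym associates_trans.

Definition divisor_space : Type := {eq_quot associates_equiv}.

HB.instance Definition _ := Choice.on divisor_space.

Definition divisor_class (m : sharp_type) : divisor_space :=
  \pi_({eq_quot associates_equiv}) m.

Definition divisor_basic (m : sharp_type) : set divisor_space :=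
  [set divisor_class n | n in [set n : sharp_type | mdivides (val n) (val m)]].

Lemma mdivides_refl m : mdivides m m.
Proof. by exists 1; rewrite scale1r. Qed.

Lemma mdivides_trans n m p : mdivides m n -> mdivides n p -> mdivides m p.
Proof. by move=> [r ->] [s ->]; exists (s * r); rewrite scalerA. Qed.

Lemma divisor_classP (m n : sharp_type) :
  divisor_class m = divisor_class n <->
  cyclic_submodule (val m) = cyclic_submodule (val n).
Proof. by split=> [/eqmodP/asboolP|mn] //; apply/eqmodP/asboolP. Qed.

Lemma divisor_basicP (m n : sharp_type) :
  divisor_basic m (divisor_class n) <-> mdivides (val n) (val m).
Proof.
split=> [[p pm /divisor_classP pn]|nm]; last by exists n.
apply: mdivides_trans pm.
have : cyclic_submodule (val p) (val p) by exists 1 => //; rewrite scale1r.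
by rewrite pn => -[r _ <-]; exists r.
Qed.

(* The basis is indexed by itself, since the library requires a pointed index
   type and sharp_type may be empty. *)
Lemma divisor_basic_cover : \bigcup_(U in range divisor_basic) U = setT.
Proof.
apply/seteqP; split=> // x _; elim/quotW: x => m.
by exists (divisor_basic m); [exists m | apply/divisor_basicP/mdivides_refl].
Qed.

Lemma divisor_basic_join (U V : set divisor_space) (x : divisor_space) :
  range divisor_basic U -> range divisor_basic V -> U x -> V x ->
  exists W, [/\ range divisor_basic W, W x & W `<=` U `&` V].
Proof.
move=> [m _ <-] [n _ <-]; elim/quotW: x => p /divisor_basicP pm /divisor_basicP pn.
exists (divisor_basic p); split; first by exists p.
  exact/divisor_basicP/mdivides_refl.
by move=> _ [q qp <-]; split; apply/divisor_basicP; apply: mdivides_trans qp _.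
Qed.

HB.instance Definition _ := isBaseTopological.Build divisor_space
  divisor_basic_cover divisor_basic_join.

End Modules.

Arguments socle {R} M _.
Arguments sharp {R} M _.

(* Main.v *)
Require Import Defs.
From mathcomp Require Import all_boot all_order all_algebra.
From mathcomp Require Import boolp classical_sets cardinality topology.

Local Open Scope classical_set_scope.
Local Open Scope ring_scope.
Import GRing.Theory.

(** The set U_m is the smallest open neighbourhood of [m], so compactness of
    D(M) yields finitely many nonzero elements m_1, ..., m_k such that every
    nonzero submodule of M contains some m_i (non-simplicity of M handles the
    elements that generate M).  Among the cyclic submodules R m_i inside a given
    nonzero submodule, one containing the fewest m_j is simple; hence every
    nonzero submodule contains one of the finitely many simple R m_i.  These
    generate the socle, which is therefore finitely generated and essential.
    If a family of submodules has zero intersection, choosing for each i a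
    member omitting m_i gives a finite subfamily with zero intersection. *)

Section Submodules.
Context {R : nzRingType} {M : lmodType R}.
Implicit Types (m x y : M) (L N : set M).

Lemma submoduleP N :
  submodule N <-> N 0 /\ forall a x y, N x -> N y -> N (a *: x + y).
Proof.
split=> [[N0 NP]|[N0 NP]]; split.
- by move: N0; rewrite inE.
- by move=> a x y Nx Ny; have := NP a x y; rewrite !inE; apply.
- by rewrite inE.
- by move=> a x y; rewrite !inE; apply: NP.
Qed.

Lemma submodule0 N : submodule N -> N 0.
Proof. by case/submoduleP. Qed.

Lemma submoduleZ N a x : submodule N -> N x -> N (a *: x).
Proof. by move=> /submoduleP[N0 NP] Nx; rewrite -[_ *: _]addr0; apply: NP. Qed.

Lemma submoduleD N x y : submodule N -> N x -> N y -> N (x + y).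
Proof. by move=> /submoduleP[_ NP] Nx Ny; rewrite -[x]scale1r; apply: NP. Qed.

Lemma submodule_sum N (I : eqType) (s : seq I) (F : I -> M) :
  submodule N -> (forall i, i \in s -> N (F i)) -> N (\sum_(i <- s) F i).
Proof.
move=> sN sF; rewrite big_seq; apply: big_ind => //; first exact: submodule0.
by move=> x y; apply: submoduleD.
Qed.

Lemma submodule_cyclic m : submodule (cyclic_submodule m).
Proof.
apply/submoduleP; split; first by exists 0 => //; rewrite scale0r.
move=> a _ _ [r _ <-] [s _ <-]; exists (a * r + s) => //.
by rewrite scalerDl scalerA.
Qed.

Lemma mem_cyclic m : cyclic_submodule m m.
Proof. by exists 1 => //; rewrite scale1r. Qed.

Lemma cyclic_sub N m : submodule N -> N m -> cyclic_submodule m `<=` N.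
Proof. by move=> sN Nm _ [r _ <-]; apply: submoduleZ. Qed.

Lemma submodule_span (I : finType) (g : I -> M) :
  submodule [set x | exists c : I -> R, x = \sum_i c i *: g i].
Proof.
apply/submoduleP; split=> [|a _ _ [c ->] [d ->]].
  by exists (fun=> 0); rewrite big1 // => i _; rewrite scale0r.
exists (fun i => a * c i + d i); rewrite scaler_sumr -big_split.
by apply: eq_bigr => i _; rewrite scalerDl scalerA.
Qed.

Lemma submodule_bigcap (I : Type) (D : set I) (N : I -> set M) :
  (forall i, submodule (N i)) -> submodule (\bigcap_(i in D) N i).
Proof.
move=> sN; apply/submoduleP; split=> [i _|a x y Nx Ny i Di].
  exact: submodule0.
by case/submoduleP: (sN i) => _; apply; [apply: Nx | apply: Ny].
Qed.

Lemma submodule_neq0 L : submodule L -> L <> [set 0] ->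
  exists2 x, L x & x != 0.
Proof.
move=> sL L0; apply: contrapT => nL; apply: L0; apply/seteqP; split=> x /=.
  by move=> Lx; apply: contrapT => /eqP x0; apply: nL; exists x.
by move=> ->; apply: submodule0.
Qed.

Lemma simple_sub_socle N : simple_submodule N -> N `<=` socle M.
Proof.
move=> sN x Nx; exists [:: x]; split; last by rewrite big_seq1.
by move=> y; rewrite inE => /eqP ->; exists N.
Qed.

Lemma submodule_socle : submodule (socle M).
Proof.
apply/submoduleP; split=> [|a _ _ [s [sP ->]] [t [tP ->]]].
  by exists [::]; rewrite big_nil.
exists ([seq a *: x | x <- s] ++ t); split; last first.
  by rewrite big_cat big_map scaler_sumr.
move=> y; rewrite mem_cat => /orP[/mapP[x /sP[N sN Nx] ->]|/tP//].
by exists N => //; apply: submoduleZ => //; case: sN.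
Qed.

Section Detecting.
Variables (I : finType) (g : I -> M).
Hypothesis g_neq0 : forall i, g i != 0.
(** All that the rest of the section retains of the topology: a finite family meeting every nonzero
    submodule. *)
Hypothesis g_detects :
  forall L, submodule L -> L <> [set 0] -> exists i, L (g i).

Let cyclic_g_neq0 i : cyclic_submodule (g i) <> [set 0].
Proof. by move=> E; have := mem_cyclic (g i); rewrite E; apply/eqP. Qed.

(** Strong induction on the number of indices [j] with [g j] in [L]: if [R g_i] is not simple, a
    smaller nonzero submodule [L'] inside it has a lower count. *)
Lemma exists_simple_cyclic L : submodule L -> L <> [set 0] ->
  exists2 i, L (g i) & simple_submodule (cyclic_submodule (g i)).
Proof.
have [n] := ubnP #|[pred j | `[< L (g j) >]]|; elim: n L => // n IHn L Ln sL L0.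
have [i Li] := g_detects _ sL L0.
have [?|nsimple] := pselect (simple_submodule (cyclic_submodule (g i))).
  by exists i.
have [L' [sL' L'i L'0 L'ne]] : exists L', [/\ submodule L',
    L' `<=` cyclic_submodule (g i), L' <> [set 0] &
    L' <> cyclic_submodule (g i)].
  apply: contrapT => nL'; apply: nsimple; split=> //.
    exact: submodule_cyclic.
  move=> L' sL' L'i; have [|L'0] := pselect (L' = [set 0]); first by left.
  by right; apply: contrapT => L'ne; apply: nL'; exists L'.
have L'L : L' `<=` L by apply: subset_trans L'i _; apply: cyclic_sub.
have [|j L'j sj] := IHn L' _ sL' L'0; last by exists j => //; apply: L'L.
rewrite -ltnS; apply: leq_trans Ln; rewrite ltnS; apply: proper_card.
apply/properP; split.
  by apply/fintype.subsetP => j; rewrite !inE; apply: L'L.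
(* The index [i] makes the inclusion strict: if [g i] were in [L'], then [L'] would be all of
   [R g_i]. *)
exists i; rewrite inE //; apply/negP; rewrite inE => L'gi; apply: L'ne.
by apply/seteqP; split=> //; exact: cyclic_sub.
Qed.

(** Some [g i] lies in [N], and minimality of [N] leaves no room between [R g_i] and [N]. Hence
    there are only finitely many simple submodules. *)
Lemma simple_cyclicP N : simple_submodule N ->
  exists i, N = cyclic_submodule (g i).
Proof.
move=> [sN N0 Nmin]; have [i Ni] := g_detects _ sN N0; exists i.
have [/cyclic_g_neq0//|->//] := Nmin _ (submodule_cyclic _) (cyclic_sub _ _ sN Ni).
Qed.

Lemma essential_socle : essential (socle M).
Proof.
split=> [|L sL SL0]; first exact: submodule_socle.
apply: contrapT => /(exists_simple_cyclic _ sL)[i Li si].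
have : (socle M `&` L) (g i).
  by split=> //; apply: (simple_sub_socle _ si); apply: mem_cyclic.
by rewrite SL0 => /eqP; apply/negP.
Qed.

Lemma socle_span : exists h : I -> M,
  socle M = [set x | exists c : I -> R, x = \sum_i c i *: h i].
Proof.
(* Generators of non-simple cyclic submodules are replaced by 0, which keeps the index type [I] and
   leaves the span inside the socle. *)
pose h i := if `[< simple_submodule (cyclic_submodule (g i)) >] then g i else 0.
exists h; apply/seteqP; split=> [_ [s [sP ->]]|_ [c ->]].
  apply: submodule_sum; first exact: submodule_span.
  move=> y /sP[N sN Ny]; have [i NE] := simple_cyclicP _ sN.
  move: sN Ny; rewrite NE => si [r _ <-].
  exists (fun j => if j == i then r else 0).
  rewrite (bigD1 i) //= eqxx /h asboolT // big1 ?addr0 // => j /negPf ->.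
  by rewrite scale0r.
apply: submodule_sum => [|i _]; first exact: submodule_socle.
apply: submoduleZ; first exact: submodule_socle.
rewrite /h; case: asboolP => [si|_]; last exact: submodule0 submodule_socle.
by apply: (simple_sub_socle _ si); apply: mem_cyclic.
Qed.

Lemma finitely_cogenerated_of_detecting : finitely_cogenerated M.
Proof.
move=> J N sN N0.
have /choice[f fP] : forall i, exists j, ~ N j (g i).
  move=> i; apply: contrapT => nN.
  have : (\bigcap_j N j) (g i).
    by move=> j _; apply: contrapT => nNj; apply: nN; exists j.
  by rewrite N0 => /eqP; apply/negP.
(* If the intersection over [range f] were nonzero, it would contain some [g i], yet [N (f i)] omits
   it. *)
exists (range f); first exact: finite_image.
apply: contrapT => /g_detects[|i /(_ (f i))]; first exact: submodule_bigcap.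
by move=> Ni; apply: (fP i); apply: Ni; exists i.
Qed.

End Detecting.

Lemma open_divisor_basic (m : sharp_type M) : open (divisor_basic m).
Proof.
exists [set divisor_basic m]; last by rewrite bigcup_set1.
by move=> _ ->; exists m.
Qed.

(** The basic sets [U_m] cover the space; [s] lists the indices of a finite subcover, and membership
    of [[n]] in [U_m] means that [n] divides [m]. *)
Lemma compact_divisor_space : cover_compact [set: divisor_space M] ->
  exists s : seq (sharp_type M),
    forall n : sharp_type M, exists2 m, m \in s & mdivides (val n) (val m).
Proof.
move=> cM.
have [||D _ DP] := cM (sharp_type M) setT (@divisor_basic R M).
- by move=> m _; apply: open_divisor_basic.
- move=> x _; elim/quotW: x => m.
  by exists m => //; apply/divisor_basicP/mdivides_refl.
exists (finmap.enum_fset D) => n.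
by have [m Dm /divisor_basicP] := DP (divisor_class n) I; exists m.
Qed.

(** Otherwise every nonzero element of [L] generates [M], so every nonzero submodule of [L] is [M];
    then [L] itself is [M], and [M] is simple. *)
Lemma sharp_in_submodule L : ~ simple_module M ->
  submodule L -> L <> [set 0] -> exists2 x, L x & sharp M x.
Proof.
move=> nsimple sL L0; apply: contrapT => nL; apply: nsimple.
have gen N x : submodule N -> N `<=` L -> N x -> x != 0 -> N = setT.
  move=> sN NL Nx x0; apply/seteqP; split=> // y _.
  have xT : cyclic_submodule x = setT.
    by apply: contrapT => xT; apply: nL; exists x => //; apply: NL.
  by apply: (cyclic_sub _ _ sN Nx); rewrite xT.
have [x Lx x0] := submodule_neq0 _ sL L0.
have LT : L = setT by apply: gen Lx x0.
rewrite /simple_module -LT; split=> // N sN NL.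
have [|/(submodule_neq0 _ sN)[y Ny y0]] := pselect (N = [set 0]); first by left.
by right; rewrite LT; apply: gen Ny y0.
Qed.

End Submodules.

Theorem theorem14 (R : idomainType) (M : lmodType R)
    (M_nonzero : nonzero_module M) (M_nonsimple : ~ simple_module M)
    (DM_compact : cover_compact [set: divisor_space M]) :
  (finitely_generated (socle M) /\ essential (socle M))
  /\ finitely_cogenerated M.
Proof.
have [s sP] := compact_divisor_space DM_compact.
pose g (i : 'I_(size s)) : M := val (tnth (in_tuple s) i).
have g_neq0 i : g i != 0.
  by have /asboolP[] := valP (tnth (in_tuple s) i).
have g_detects L : submodule L -> L <> [set 0] -> exists i, L (g i).
  move=> sL /(sharp_in_submodule _ M_nonsimple sL)[x Lx /asboolP x_sharp].
  (* The listed element is a multiple of [x], hence stays in [L]. *)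
  have [m /seq_tnthP[i ->] [r gE]] := sP (Sub x x_sharp).
  by exists i; rewrite /g gE SubK; apply: submoduleZ.
split; last exact: finitely_cogenerated_of_detecting g_detects.
split; last exact: essential_socle g_neq0 g_detects.
have [h hE] := socle_span _ _ g_neq0 g_detects.
by exists (size s), h.
Qed.
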